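(* Let $f,g,h,L,\gamma$ satisfy the assumptions in the context, let $\varphi(x)=f(x)+g(x)+h(Lx)$ on $\mathbb{R}^n$, let $\varphi^\gamma$ be the envelope defined in the context, and let $z^*\in\mathbb{R}^n$. Then: 1. If $P_{\gamma g}(z^* )\in \arg\min_{x\in B(P_{\gamma g}(z^* ),\delta)}\varphi(x)$ for some $\delta>0$, then $z^*$ is a local minimizer of $\varphi^{\gamma}$. 2. If $z^*\in \arg\min_{z\in B(z^*,\varepsilon)}\varphi^{\gamma}(z)$ for some $\varepsilon>0$, then $\varphi\big(P_{\gamma g}(z^* )\big)\leq \varphi\big(P_{\gamma g}(z)\big)$ for all $z$ such that $\|z-z^*\|\leq \varepsilon$; that is, $P_{\gamma g}(z^* )$ is a local minimizer of $\varphi$.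
   Context: Notation. For $\xi:\mathbb{R}^n\to\mathbb{R}\cup\{\infty\}$ and $\gamma>0$: $P_{\gamma \xi}(z)=\arg\min_{u\in\mathbb{R}^n}\{\xi(u)+\frac{1}{2\gamma}\|u-z\|^2\}$ is the proximal mapping and $\xi^{\gamma}(z)=\inf_{u\in\mathbb{R}^n}\{\xi(u)+\frac{1}{2\gamma}\|z-u\|^2\}$ is the Moreau envelope. A function is $\beta$-weakly convex if adding $\frac{\beta}{2}\|\cdot\|^2$ makes it convex. ''$M$-Lipschitz differentiable'' means differentiable with $M$-Lipschitz gradient. $\|\cdot\|$ is the Euclidean norm (operator norm for $L$), and $1/0=+\infty$. $B(x,r)$ is the closed ball of center $x$ and radius $r$. The $\arg\min$ of a function identically $+\infty$ on the set considered is taken to be empty (so a minimizer of $\varphi$ has finite value). Assumptions. $L:\mathbb{R}^n\to\mathbb{R}^m$ is linear; $g:\mathbb{R}^n\to\mathbb{R}$ is $L_g$-Lipschitz differentiable; $h:\mathbb{R}^m\to\mathbb{R}$ is $L_h$-Lipschitz differentiable; $f:\mathbb{R}^n\to\mathbb{R}\cup\{\infty\}$ is proper and lower semicontinuous; $\gamma\in(0,\frac{1}{L_g+L_h\|L\|^2})$; and $f+\frac{1}{2\gamma'}\|\cdot\|^2$ is bounded below for every $\gamma'\in(0,\frac{1}{L_g+L_h\|L\|^2})$. Moreover $f$ is $\beta_f$-weakly convex, $\gamma\in(0,\frac{1}{\beta_f})$, and $g,h$ are twice continuously differentiable. Under these assumptions $P_{\gamma g}$ and $P_{\gamma f}$ are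 single-valued. Envelope. With $q(z)=L^T\nabla h\big(LP_{\gamma g}(z)\big)$, $$\varphi^{\gamma}(z) = g^{\gamma}(z)-\gamma \|\nabla g^{\gamma}(z)\|^2-\gamma \langle q(z), \nabla g^{\gamma}(z)\rangle +h\big(LP_{\gamma g}(z)\big)-\frac{\gamma}{2}\|q(z)\|^2 +f^{\gamma}\big(z-2\gamma \nabla g^{\gamma}(z)-\gamma q(z)\big).$$ *)

(* Defs.v *)
(* Vectors of R^n are row vectors 'rV[R]_n. *)
From HB Require Import structures.
From mathcomp Require Export all_boot all_order all_algebra.
From mathcomp Require Export all_classical all_reals all_analysis.
Export Order.TTheory GRing.Theory Num.Theory.
Export numFieldNormedType.Exports.

Set Implicit Arguments.
Unset Strict Implicit.
Unset Printing Implicit Defensive.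

Local Open Scope classical_set_scope.
Local Open Scope ring_scope.

Section Defs.
Context {R : realType}.

(* The library norm `|x| on 'rV[R]_n is the max norm. It induces the usual
   topology and differentiability, but all quantitative notions below use the
   Euclidean norm. *)
Definition dot n (x y : 'rV[R]_n) : R := \sum_i x 0 i * y 0 i.

Definition enorm n (x : 'rV[R]_n) : R := Num.sqrt (dot x x).

Definition eball n (c : 'rV[R]_n) (r : R) : set 'rV[R]_n :=
  closed_ball_ (@enorm n) c r.

Definition opnorm n m (L : {linear 'rV[R]_n -> 'rV[R]_m}) : R :=
  sup [set enorm (L x) | x in [set x | enorm x <= 1]].

(* [lin1_mx L] acts on the right: [x *m lin1_mx L = L x]. *)
Definition adjoint n m (L : {linear 'rV[R]_n -> 'rV[R]_m}) (y : 'rV[R]_m) :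
  'rV[R]_n := y *m (lin1_mx L)^T.

Lemma dot_adjoint n m (L : {linear 'rV[R]_n -> 'rV[R]_m}) x y :
  dot (L x) y = dot x (adjoint L y).
Proof.
have dotE k (u v : 'rV[R]_k) : dot u v = (u *m v^T) 0 0.
  by rewrite mxE; apply: eq_bigr => i _; rewrite mxE.
by rewrite !dotE /adjoint trmx_mul trmxK mulmxA mul_rV_lin1.
Qed.

Definition grad n (g : 'rV[R]_n -> R) (x : 'rV[R]_n) : 'rV[R]_n :=
  \row_i 'D_(delta_mx 0 i) g x.

Definition lipschitz_differentiable n (M : R) (g : 'rV[R]_n -> R) : Prop :=
  (forall x, differentiable g x) /\
  (forall x y, enorm (grad g x - grad g y) <= M * enorm (x - y)).

Definition twice_continuously_differentiable n (g : 'rV[R]_n -> R) : Prop :=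
  [/\ forall x, differentiable g x,
      forall x, differentiable (grad g) x &
      continuous (jacobian (grad g))].

Local Open Scope ereal_scope.

Definition proper n (f : 'rV[R]_n -> \bar R) : Prop :=
  (forall x, f x != -oo) /\ (exists x, f x < +oo).

Definition bounded_below n (f : 'rV[R]_n -> \bar R) : Prop :=
  exists c : R, forall x, c%:E <= f x.

Definition add_sqnorm n (a : R) (f : 'rV[R]_n -> \bar R) (x : 'rV[R]_n) :
  \bar R := f x + (a * enorm x ^+ 2)%:E.

(* For functions that avoid -oo; since 0 * +oo = 0, the cases t = 0 and t = 1
   are trivial. *)
Definition econvex n (f : 'rV[R]_n -> \bar R) : Prop :=
  forall (x y : 'rV[R]_n) (t : R), (0 <= t <= 1)%R ->
    f (t *: x + (1 - t) *: y)%R <= t%:E * f x + (1 - t)%:E * f y.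

Definition weakly_convex n (b : R) (f : 'rV[R]_n -> \bar R) : Prop :=
  econvex (add_sqnorm (b / 2) f).

(* Empty when F is identically +oo on A. *)
Definition argmin n (A : set 'rV[R]_n) (F : 'rV[R]_n -> \bar R) :
  set 'rV[R]_n :=
  [set x | [/\ A x, F x < +oo & forall y, A y -> F x <= F y]].

Definition local_minimizer n (F : 'rV[R]_n -> \bar R) (x : 'rV[R]_n) : Prop :=
  exists2 r : R, (0 < r)%R & argmin (eball x r) F x.

Definition prox_obj n (c : R) (xi : 'rV[R]_n -> \bar R) (z u : 'rV[R]_n) :
  \bar R := xi u + ((2 * c)^-1 * enorm (u - z) ^+ 2)%:E.

Definition prox_set n (c : R) (xi : 'rV[R]_n -> \bar R) (z : 'rV[R]_n) :
  set 'rV[R]_n := argmin setT (prox_obj c xi z).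

(* The point of [prox_set c xi z], meaningful when that set is a singleton
   (junk value 0 if it is empty). *)
Definition prox n (c : R) (xi : 'rV[R]_n -> \bar R) (z : 'rV[R]_n) :
  'rV[R]_n := xget 0%R (prox_set c xi z).

Definition moreau n (c : R) (xi : 'rV[R]_n -> \bar R) (z : 'rV[R]_n) :
  \bar R := ereal_inf (range (prox_obj c xi z)).

Section Envelope.
Variables (n m : nat) (L : {linear 'rV[R]_n -> 'rV[R]_m}).
Variables (f : 'rV[R]_n -> \bar R) (g : 'rV[R]_n -> R) (h : 'rV[R]_m -> R).

Definition objective (x : 'rV[R]_n) : \bar R :=
  f x + (g x)%:E + (h (L x))%:E.

Variable c : R.

Definition prox_g (z : 'rV[R]_n) : 'rV[R]_n := prox c (EFin \o g) z.

Definition grad_moreau_g (z : 'rV[R]_n) : 'rV[R]_n :=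
  grad (fine \o moreau c (EFin \o g)) z.

Definition qvec (z : 'rV[R]_n) : 'rV[R]_n :=
  adjoint L (grad h (L (prox_g z))).

Definition envelope (z : 'rV[R]_n) : \bar R :=
  moreau c (EFin \o g) z
  - (c * enorm (grad_moreau_g z) ^+ 2)%:E
  - (c * dot (qvec z) (grad_moreau_g z))%:E
  + (h (L (prox_g z)))%:E
  - (c / 2 * enorm (qvec z) ^+ 2)%:E
  + moreau c f (z - (2 * c) *: grad_moreau_g z - c *: qvec z)%R.

End Envelope.
End Defs.

(* Main.v *)
Require Import Defs.
From mathcomp Require Import ring lra.

Set Implicit Arguments.
Unset Strict Implicit.
Unset Printing Implicit Defensive.

Local Open Scope classical_set_scope.
Local Open Scope ring_scope.

(** Write F = g + h o L for the smooth part of the objective phi = f + F, and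
    c for the step (gamma in the informal text). Completing squares shows that
    the three-operator envelope is a forward-backward envelope read through
    the proximal map of g: with x = P_{cg}(z),

      envelope z = inf_u f(u) + F(x) + <grad F(x), u - x> + |u - x|^2 / (2c)

    ([envelopeE]). The expression to be minimized is the model at x, and fbe(x)
    denotes its infimum. Since z = x + c grad
    g(x), the map z |-> x is Lipschitz and inverted by the Lipschitz map
    x |-> x + c grad g(x), so that neighbourhoods of zs and of xs = P_{cg}(zs)
    correspond, and both claims become claims about fbe and phi near xs.
    The gradient of F has Lipschitz constant K = Lg + Lh |L|^2 and c K < 1, so
    the model in u lies above phi(u) and touches it at u = x; in particular
    fbe <= phi.

    First claim ([fb_envelope_locally_ge]). Let xs minimize phi on a ball and
    let y be close to xs. For u in the ball, the model at y is at least
    phi(u) >= phi(xs). For u outside, cut the segment from xs to u at the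
    sphere: there the model exceeds phi(xs) by a fixed amount, while at xs it
    exceeds phi(xs) by only O(|xs - y|^2), and the model is convex in u because
    c bf < 1; hence its value at u is at least phi(xs) as well. Thus
    fbe(y) >= phi(xs) >= fbe(xs).

    Second claim ([sum_le_fb_envelope]). The point is that a local minimizer
    xs of fbe satisfies phi(xs) <= fbe(xs). Freeze u and move the base point
    from xs by a fraction t towards u: to first order in t the model
    decreases by t (1/c - K) |u - xs|^2 ([fb_model_step]), yet it remains
    above fbe(xs). So points u at a distance from xs have model values bounded
    away from fbe(xs): the infimum is approached only as u tends to xs, and
    lower semicontinuity of f gives phi(xs) <= fbe(xs). Then
    phi(xs) <= fbe(xs) <= fbe(y) <= phi(y) wherever fbe(xs) <= fbe(y). *)

(** * Euclidean geometry of row vectors *)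

Section Euclid.
Context {R : realType} {n : nat}.
Implicit Types (x y z : 'rV[R]_n) (a : R).

Lemma dotC x y : dot x y = dot y x.
Proof. by apply: eq_bigr => i _; rewrite mulrC. Qed.

Lemma dotDl x y z : dot (x + y) z = dot x z + dot y z.
Proof. by rewrite -big_split; apply: eq_bigr => i _; rewrite mxE mulrDl. Qed.

Lemma dotZl a x y : dot (a *: x) y = a * dot x y.
Proof. by rewrite mulr_sumr; apply: eq_bigr => i _; rewrite mxE mulrA. Qed.

Lemma dotNl x y : dot (- x) y = - dot x y.
Proof. by rewrite -scaleN1r dotZl mulN1r. Qed.

Lemma dotDr x y z : dot x (y + z) = dot x y + dot x z.
Proof. by rewrite dotC dotDl !(dotC x). Qed.

Lemma dotZr a x y : dot x (a *: y) = a * dot x y.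
Proof. by rewrite dotC dotZl dotC. Qed.

Lemma dotNr x y : dot x (- y) = - dot x y.
Proof. by rewrite dotC dotNl dotC. Qed.

Definition dotE := (dotDl, dotDr, dotZl, dotZr, dotNl, dotNr).

Lemma dot_ge0 x : 0 <= dot x x.
Proof. by apply: sumr_ge0 => i _; rewrite -expr2 sqr_ge0. Qed.

Lemma dot0r x : dot x 0 = 0.
Proof. by rewrite -(scale0r x) dotZr mul0r. Qed.

Lemma dot_delta x i : dot x (delta_mx 0 i) = x 0 i.
Proof.
rewrite /dot (bigD1 i)//= big1 => [|j ji]; first by rewrite mxE !eqxx mulr1 addr0.
by rewrite mxE (negbTE ji) andbF mulr0.
Qed.

Lemma dotxx_eq0 x : dot x x = 0 -> x = 0.
Proof.
have sq_ge0 (i : 'I_n) : true -> 0 <= x 0 i * x 0 i by rewrite -expr2 sqr_ge0.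
move=> /(psumr_eq0P sq_ge0) x0; apply/rowP => i; rewrite mxE.
by have /eqP := x0 i isT; rewrite mulf_eq0 orbb => /eqP.
Qed.

Lemma enorm_ge0 x : 0 <= enorm x.
Proof. exact: sqrtr_ge0. Qed.

Lemma sqr_enorm x : enorm x ^+ 2 = dot x x.
Proof. by rewrite sqr_sqrtr ?dot_ge0. Qed.

Lemma enorm0 : enorm (0 : 'rV[R]_n) = 0.
Proof. by rewrite /enorm dot0r sqrtr0. Qed.

Lemma enorm_eq0 x : enorm x = 0 -> x = 0.
Proof. by move=> x0; apply: dotxx_eq0; rewrite -sqr_enorm x0 expr0n. Qed.

Lemma enormZ a x : enorm (a *: x) = `|a| * enorm x.
Proof. by rewrite /enorm dotZl dotZr mulrA -expr2 sqrtrM ?sqr_ge0// sqrtr_sqr. Qed.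

Lemma enormN x : enorm (- x) = enorm x.
Proof. by rewrite -scaleN1r enormZ normrN1 mul1r. Qed.

Lemma enormBC x y : enorm (x - y) = enorm (y - x).
Proof. by rewrite -enormN opprB. Qed.

(** Cauchy-Schwarz, from 0 <= | |y| x - |x| y |^2. *)
Lemma dot_le_enorm x y : dot x y <= enorm x * enorm y.
Proof.
have [/enorm_eq0 ->|x0] := eqVneq (enorm x) 0; first by rewrite dotC dot0r enorm0 mul0r.
have [/enorm_eq0 ->|y0] := eqVneq (enorm y) 0; first by rewrite dot0r enorm0 mulr0.
have xy_gt0 : 0 < enorm x * enorm y by rewrite mulr_gt0 ?lt_def ?x0 ?y0 ?enorm_ge0.
have := dot_ge0 (enorm y *: x - enorm x *: y).
rewrite !dotE (dotC y x) -!sqr_enorm => H.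
rewrite -(ler_pM2l xy_gt0); nra.
Qed.

Lemma normr_dot_le_enorm x y : `|dot x y| <= enorm x * enorm y.
Proof.
by rewrite ler_norml dot_le_enorm andbT lerNl -dotNl -(enormN x) dot_le_enorm.
Qed.

Lemma enormD x y : enorm (x + y) <= enorm x + enorm y.
Proof.
rewrite -(ler_pXn2r (ltn0Sn 1)) ?nnegrE ?addr_ge0 ?enorm_ge0//.
rewrite sqrrD !sqr_enorm !dotE (dotC y x).
have := dot_le_enorm x y; lra.
Qed.

(** Half of the equivalence of norms: it makes Euclidean-bounded sets bounded,
    and neighbourhoods contain Euclidean balls. *)
Lemma normr_le_enorm x : `|x| <= enorm x.
Proof.
rewrite [`|x|]mx_normrE; apply: bigmax_le; first exact: enorm_ge0.
move=> [i j] _; rewrite ord1 /= -sqrtr_sqr ler_sqrt ?dot_ge0// /dot.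
rewrite (bigD1 j)//= expr2 lerDl.
by apply: sumr_ge0 => k _; rewrite -expr2 sqr_ge0.
Qed.

Lemma continuous_dotBl z : continuous (fun x => dot (x - z) (x - z)).
Proof.
have coord_sq (i : 'I_n) : continuous (fun x : 'rV[R]_n => (x - z) 0 i * (x - z) 0 i).
  move=> x; suff coordB : (fun y => (y - z) 0 i) @ x --> (x - z) 0 i.
    exact: (cvgM coordB coordB).
  have -> : (fun y => (y - z) 0 i) = (fun y : 'rV[R]_n => y 0 i - z 0 i).
    by apply/funext => y; rewrite !mxE.
  rewrite !mxE; have coord := @coord_continuous R 1 n 0 i x.
  exact: (cvgB coord (cvg_cst (z 0 i))).
apply: continuous_big => [x|i _]; last exact: coord_sq.
exact: (cvgD cvg_fst cvg_snd).
Qed.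

Lemma nbhs_enorm (V : set 'rV[R]_n) x : nbhs x V ->
  exists2 r : R, 0 < r & forall y, enorm (y - x) < r -> V y.
Proof.
case/nbhs_ballP => r /= r0 rV; exists r => // y yr; apply: rV.
rewrite -ball_normE /ball_/= distrC; exact: le_lt_trans (normr_le_enorm _) yr.
Qed.

End Euclid.

(** * Operator norm *)

Section Operator.
Context {R : realType} {n m : nat} (L : {linear 'rV[R]_n -> 'rV[R]_m}).

(** Cauchy-Schwarz in each coordinate of L x. The bound makes the supremum
    in [opnorm] that of a bounded set. *)
Lemma enorm_linear_bound : exists C : R, forall x, enorm (L x) <= C * enorm x.
Proof.
pose col (j : 'I_m) : 'rV[R]_n := \row_i L (delta_mx 0 i) 0 j.
have LE x j : L x 0 j = dot x (col j).
  rewrite {1}[x]row_sum_delta linear_sum summxE; apply: eq_bigr => i _.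
  by rewrite linearZ !mxE.
exists (Num.sqrt (\sum_j dot (col j) (col j))) => x.
rewrite /enorm -sqrtrM; last by apply: sumr_ge0 => j _; exact: dot_ge0.
rewrite ler_sqrt; last by rewrite mulr_ge0 ?dot_ge0// sumr_ge0// => j _; exact: dot_ge0.
rewrite {1}/dot mulr_suml; apply: ler_sum => j _.
rewrite LE -expr2 -(sqr_enorm (col j)) -(sqr_enorm x) -exprMn mulrC.
rewrite -real_normK ?num_real// ler_pXn2r ?nnegrE ?normr_ge0 ?mulr_ge0 ?enorm_ge0//.
exact: normr_dot_le_enorm.
Qed.

Lemma opnorm_ge0 : 0 <= opnorm L.
Proof.
rewrite /opnorm; have [C LC] := enorm_linear_bound.
apply: (@le_trans _ _ (enorm (L 0))); first exact: enorm_ge0.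
apply: ub_le_sup; last by exists 0 => //=; rewrite enorm0 ler01.
exists `|C| => _ [x /= x1 <-]; apply: le_trans (LC x) _.
rewrite -[leRHS]mulr1; apply: le_trans (ler_wpM2l (normr_ge0 C) x1).
by rewrite ler_wpM2r ?enorm_ge0 ?ler_norm.
Qed.

Lemma enorm_le_opnorm x : enorm (L x) <= opnorm L * enorm x.
Proof.
have [C LC] := enorm_linear_bound.
have [x0|x0] := eqVneq (enorm x) 0.
  by rewrite (enorm_eq0 x0) linear0 !enorm0 mulr0.
have x_gt0 : 0 < enorm x by rewrite lt_def x0 enorm_ge0.
rewrite -ler_pdivrMr// mulrC -[X in X * _]ger0_norm ?invr_ge0 ?enorm_ge0//.
rewrite -enormZ -linearZ; apply: ub_le_sup.
  exists `|C| => _ [y /= y1 <-]; apply: le_trans (LC y) _.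
  rewrite -[leRHS]mulr1; apply: le_trans (ler_wpM2l (normr_ge0 C) y1).
  by rewrite ler_wpM2r ?enorm_ge0 ?ler_norm.
exists ((enorm x)^-1 *: x) => //=.
by rewrite enormZ ger0_norm ?invr_ge0 ?enorm_ge0// mulVf.
Qed.

End Operator.

(** * Two-sided quadratic bounds from Lipschitz gradients *)

Section Descent.
Context {R : realType}.

(** All that the argument uses of the smooth part F and its gradient G. Unlike
    Lipschitz continuity of the gradient, it passes to F o L by mere
    substitution. *)
Definition quadratic_approx n (M : R) (F : 'rV[R]_n -> R)
    (G : 'rV[R]_n -> 'rV[R]_n) :=
  forall x y, `|F y - F x - dot (G x) (y - x)| <= M / 2 * enorm (y - x) ^+ 2.

Lemma dot_grad n (g : 'rV[R]_n -> R) x v :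
  differentiable g x -> 'D_v g x = dot (grad g x) v.
Proof.
move=> dg; rewrite deriveE// {1}[v]row_sum_delta linear_sum /=.
by apply: eq_bigr => i _; rewrite linearZ mxE deriveE// mulrC.
Qed.

Lemma is_derive_line n (g : 'rV[R]_n -> R) x v (t : R) :
  differentiable g (x + t *: v) ->
  is_derive t 1 (fun s => g (x + s *: v)) (dot (grad g (x + t *: v)) v).
Proof.
move=> dg; have gv := @diff_derivable _ _ _ _ _ v dg.
have quotE : (fun h => h^-1 *: (g (x + (h *: 1 + t) *: v) - g (x + t *: v)))
  = (fun h => h^-1 *: (g (h *: v + (x + t *: v)) - g (x + t *: v))).
  apply/funext => h; congr (_ *: (g _ - _)).
  by rewrite -[h *: 1]/(h * 1) mulr1 scalerDl addrCA.
apply: DeriveDef; first by rewrite /derivable /= quotE.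
by rewrite -dot_grad// /derive /= quotE.
Qed.

(** Both bounds come from monotonicity on [0, 1] of
    s (p t - t D 0) - B t^2 / 2, for s = 1 and s = -1. *)
Lemma quadratic_approx_line (p D : R -> R) (B : R) :
  (forall t : R, is_derive t 1 p (D t)) ->
  (forall t : R, 0 <= t <= 1 -> `|D t - D 0| <= B * t) ->
  `|p 1 - p 0 - D 0| <= B / 2.
Proof.
move=> pD DB.
have half (s : R) : (s = 1 \/ s = -1) -> s * (p 1 - p 0 - D 0) <= B / 2.
  move=> s1; pose q t := s * p t - (s * D 0) * t - (B / 2) * (t * t).
  have qD (t : R) : is_derive t 1 q (s * D t - s * D 0 - B * t).
    have dp := is_deriveZ s (pD t).
    have d1 := is_deriveZ (s * D 0) (is_derive_id t 1).
    have d2 := is_deriveZ (B / 2) (is_deriveX 2 (is_derive_id t 1)).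
    have -> : q = s \*: p - (s * D 0) \*: id - (B / 2) \*: id ^+ 2.
      by apply/funext => u; rewrite /q expr2.
    apply: (is_derive_eq (is_deriveB (is_deriveB dp d1) d2)).
    by rewrite /GRing.scale /=; field.
  have cq : {within `[0, 1], continuous q}.
    apply: continuous_subspaceT => t; apply: differentiable_continuous.
    exact/derivable1_diffP.
  have : q 1 <= q 0.
    apply: (@ler0_derive1_nincr _ q 0 1) => // t.
    rewrite in_itv/= => /andP[t0 t1].
    rewrite derive1E derive_val.
    have := DB t; rewrite (ltW t0) (ltW t1) ler_norml => /(_ isT)/andP[].
    by case: s1 => ->; lra.
  by rewrite /q; lra.
rewrite ler_norml; have := half 1 (or_introl erefl); have := half (-1) (or_intror erefl).
lra.
Qed.

(** The descent lemma, in both directions. *)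
Lemma quadratic_approx_grad n (M : R) (g : 'rV[R]_n -> R) :
  lipschitz_differentiable M g -> quadratic_approx M g (grad g).
Proof.
move=> [dg lip] x y; pose d := y - x.
have yE : x + 1 *: d = y by rewrite scale1r /d addrC subrK.
have := @quadratic_approx_line (fun t => g (x + t *: d))
  (fun t => dot (grad g (x + t *: d)) d) (M * enorm d ^+ 2).
rewrite /= yE scale0r addr0 mulrAC; apply => [t|t /andP[t0 t1]].
  exact: is_derive_line.
rewrite -dotNl -dotDl; apply: le_trans (normr_dot_le_enorm _ _) _.
apply: le_trans (ler_wpM2r (enorm_ge0 _) (lip _ _)) _.
by rewrite addrAC subrr add0r enormZ ger0_norm// le_eqVlt; apply/orP; left; apply/eqP; ring.
Qed.

Lemma quadratic_approxD n (M N : R) (F F' : 'rV[R]_n -> R) G G' :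
  quadratic_approx M F G -> quadratic_approx N F' G' ->
  quadratic_approx (M + N) (fun x => F x + F' x) (fun x => G x + G' x).
Proof.
move=> FG FG' x y; move: (FG x y) (FG' x y); rewrite !ler_norml dotDl => /andP[? ?] /andP[? ?].
by apply/andP; split; lra.
Qed.

(** The bound is only needed along the range of L, where |L x| is compared
    with |x|. *)
Lemma quadratic_approx_linear n m (L : {linear 'rV[R]_n -> 'rV[R]_m}) (M N : R)
    (F : 'rV[R]_m -> R) G :
  (forall x, M * enorm (L x) ^+ 2 <= N * enorm x ^+ 2) ->
  quadratic_approx M F G ->
  quadratic_approx N (fun x => F (L x)) (fun x => adjoint L (G (L x))).
Proof.
move=> MN FG x y; rewrite dotC -dot_adjoint dotC linearB.
apply: le_trans (FG _ _) _; have := MN (y - x); rewrite linearB; lra.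
Qed.

End Descent.

(** * Infima, Moreau envelopes and directional derivatives *)

Section Infimum.
Context {R : realType}.

Lemma ereal_infDl (T : Type) (a : R) (k : T -> \bar R) :
  (a%:E + ereal_inf (range k))%E = ereal_inf (range (fun u => a%:E + k u)%E).
Proof.
apply/eqP; rewrite eq_le; apply/andP; split.
  by apply/ereal_infP => _ [u _ <-]; apply/leeD2l/ereal_inf_lbound; exists u.
rewrite -leeBlDl//; apply/ereal_infP => _ [u _ <-].
by rewrite leeBlDl//; apply: ereal_inf_lbound; exists u.
Qed.

Lemma moreau_prox n (c : R) (xi : 'rV[R]_n -> \bar R) z x :
  prox_set c xi z x -> moreau c xi z = prox_obj c xi z x.
Proof.
move=> [_ _ xmin]; apply/eqP; rewrite eq_le; apply/andP; split.
  by apply: ereal_inf_lbound; exists x.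
by apply/ereal_infP => _ [u _ <-]; exact: xmin.
Qed.

(** Identifies the gradient of the Moreau envelope from a second-order
    sandwich, without differentiating the proximal map. *)
Lemma derive_of_quadratic n (F : 'rV[R]_n -> R) z v (a C : R) :
  (forall h : R, `|F (z + h *: v) - F z - h * a| <= C * h ^+ 2) -> 'D_v F z = a.
Proof.
move=> FC; rewrite /derive; apply: cvg_lim; first exact: Rhausdorff.
apply/cvgrPdist_le => e e0.
have eC : 0 < e / (`|C| + 1) by rewrite divr_gt0// ltr_wpDl.
near=> h.
have h0 : h != 0 by near: h; exact: nbhs_dnbhs_neq.
rewrite distrC -(ler_pM2l (_ : 0 < `|h|)) ?normr_gt0// -normrM.
rewrite mulrBr /GRing.scale/= mulVKf// (addrC (_ *: v)).
apply: le_trans (FC h) _; rewrite -(real_normK (num_real h)) expr2 mulrCA.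
apply: ler_wpM2l; first exact: normr_ge0.
apply: (@le_trans _ _ ((`|C| + 1) * `|h|)).
  by rewrite ler_wpM2r ?normr_ge0// (le_trans (ler_norm C))// lerDl.
rewrite mulrC -ler_pdivlMr ?ltr_wpDl//.
by near: h; exact: dnbhs0_le.
Unshelve. all: by end_near. Qed.

End Infimum.

(** * The proximal map of a smooth function *)

Section ProxSmooth.
Context {R : realType} {n : nat}.
Variables (g : 'rV[R]_n -> R) (c M : R).
Hypothesis c_gt0 : 0 < c.
Hypothesis cM_lt1 : c * M < 1.
Hypothesis g_smooth : lipschitz_differentiable M g.

Let g_quad := quadratic_approx_grad g_smooth.

Let ltMc : M < c^-1. Proof. by rewrite -(ltr_pM2l c_gt0) divff// gt_eqF. Qed.

Let inv2c : (2 * c)^-1 = c^-1 / 2. Proof. by field; rewrite gt_eqF. Qed.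

(** The objective of the proximal problem is continuous, and the descent lemma
    together with c M < 1 makes it coercive; so a minimizer over a large ball is
    a global one. *)
Lemma prox_smooth_nonempty z : exists x, prox_set c (EFin \o g) z x.
Proof.
pose o u := g u + (2 * c)^-1 * enorm (u - z) ^+ 2.
pose k := (c^-1 - M) / 2.
have k_gt0 : 0 < k by rewrite divr_gt0// subr_gt0.
(* for |u - z| > rho, k |u - z|^2 dominates |grad g z| |u - z| *)
pose rho := enorm (grad g z) / k + 1.
have rho_gt0 : 0 < rho by rewrite ltr_wpDl// divr_ge0 ?enorm_ge0 ?ltW.
pose A := [set u : 'rV[R]_n | dot (u - z) (u - z) <= rho ^+ 2].
have A_enorm u : A u <-> enorm (u - z) <= rho.
  by rewrite /A/= -sqr_enorm ler_pXn2r// nnegrE ?enorm_ge0 ?ltW.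
have Az : A z by apply/A_enorm; rewrite subrr enorm0 ltW.
have A_compact : compact A.
  apply: bounded_closed_compact.
    exists (rho + `|z|); split; first exact: num_real.
    move=> M' M'gt u /A_enorm uA; apply: ltW; apply: le_lt_trans M'gt.
    rewrite -(subrK z u); apply: le_trans (ler_normD _ _) _.
    by rewrite lerD2r; exact: le_trans (normr_le_enorm _) uA.
  rewrite (_ : A = (fun u : 'rV[R]_n => dot (u - z) (u - z)) @^-1` [set r | r <= rho ^+ 2])//.
  apply: closed_comp; last exact: closed_le.
  by move=> u _; exact: continuous_dotBl.
have o_cont : {within A, continuous o}.
  rewrite (_ : o = fun u => g u + (2 * c)^-1 * dot (u - z) (u - z)); last first.
    by apply/funext => u; rewrite -sqr_enorm.
  apply: continuous_subspaceT => u.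
  have g_cont : g @ u --> g u := differentiable_continuous (g_smooth.1 u).
  exact: (cvgD g_cont (cvgM (cvg_cst _) (@continuous_dotBl R n z u))).
have [x /set_mem Ax xmin] := EVT_min_rV (ex_intro _ z Az) A_compact o_cont.
exists x; split=> //= [|u _]; first exact: ltry.
rewrite /prox_obj/= -!EFinD lee_fin -/(o x) -/(o u).
have [uA|uA] := lerP (enorm (u - z)) rho; first by apply: xmin; apply/mem_set/A_enorm.
(* outside the ball the quadratic term beats the descent of g *)
apply: (le_trans (xmin z _)); first exact: mem_set.
rewrite /o subrr enorm0.
have := g_quad z u; rewrite ler_norml => /andP[glb _].
have := normr_dot_le_enorm (grad g z) (u - z); rewrite ler_norml => /andP[dlb _].
have : enorm (grad g z) <= k * enorm (u - z).
  by rewrite mulrC -ler_pdivrMr//; apply: le_trans (ltW uA); rewrite lerDl.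
move=> /(ler_wpM2r (enorm_ge0 (u - z))); rewrite inv2c /k.
move: (enorm (u - z)) (enorm (grad g z)) glb dlb => d e; nra.
Qed.

(** Let e be the gradient of the proximal objective at its minimizer x. By the
    descent lemma, the step - t e changes the objective by at most
    - t |e|^2 + C t^2 |e|^2, which is negative for small t unless e = 0. *)
Lemma prox_smooth_stationary z x :
  prox_set c (EFin \o g) z x -> x + c *: grad g x = z.
Proof.
move=> [_ _ xmin]; pose e := grad g x + c^-1 *: (x - z).
suff /dotxx_eq0 e0 : dot e e = 0.
  have := congr1 (fun v => c *: v) e0.
  rewrite /e scalerDr scalerA divff ?gt_eqF// scale1r scaler0 => ce0.
  by apply/eqP; rewrite -subr_eq0 -ce0; apply/eqP; rewrite addrAC addrC.
pose C := M / 2 + c^-1 / 2; pose t := (`|C| + 1)^-1.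
have t_gt0 : 0 < t by rewrite invr_gt0 ltr_wpDl.
have tC : t * C < 1.
  rewrite -[X in _ < X](@mulVf _ (`|C| + 1)) ?gt_eqF ?ltr_wpDl// ltr_pM2l//.
  by rewrite ltr_pwDr// ler_norm.
have eE : dot e e = dot (grad g x) e + c^-1 * dot (x - z) e by rewrite {1}/e dotDl dotZl.
have := xmin (x - t *: e) I; rewrite /prox_obj/= -!EFinD lee_fin inv2c.
have := g_quad x (x - t *: e); rewrite ler_norml => /andP[_].
rewrite (addrAC x _ (- x)) subrr add0r (addrAC x _ (- z)) !sqr_enorm.
clearbody e; move: (x - z) eE => d eE.
rewrite !dotE (dotC e d) => g_le o_le.
have : t * dot e e * (1 - t * C) <= 0 by rewrite /C; nra.
rewrite pmulr_lle0 ?subr_gt0// pmulr_rle0// => e_le0.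
by apply/eqP; rewrite eq_le e_le0 dot_ge0.
Qed.

Lemma prox_smooth_eq z : prox_g g c z + c *: grad g (prox_g g c z) = z.
Proof.
have [x xP] := prox_smooth_nonempty z.
exact/prox_smooth_stationary/(xgetPex 0 (ex_intro _ x xP)).
Qed.

Lemma prox_smoothP z : prox_set c (EFin \o g) z (prox_g g c z).
Proof. by have [x xP] := prox_smooth_nonempty z; exact: (xgetPex 0 (ex_intro _ x xP)). Qed.

(** The source of both the injectivity of x |-> x + c grad g x and the Lipschitz
    constant of its inverse, the proximal map. *)
Lemma gradient_step_expand x x' :
  (1 - c * M) * enorm (x - x')
  <= enorm ((x + c *: grad g x) - (x' + c *: grad g x')).
Proof.
have := enormD ((x + c *: grad g x) - (x' + c *: grad g x'))
  (- (c *: (grad g x - grad g x'))).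
rewrite enormN enormZ (gtr0_norm c_gt0).
rewrite (_ : _ + - (c *: _) = x - x'); last first.
  by rewrite scalerBr; apply/rowP => i; rewrite !mxE; ring.
have := ler_wpM2l (ltW c_gt0) (g_smooth.2 x x'); lra.
Qed.

Lemma prox_smooth_lipschitz z z' :
  (1 - c * M) * enorm (prox_g g c z - prox_g g c z') <= enorm (z - z').
Proof. by apply: le_trans (gradient_step_expand _ _) _; rewrite !prox_smooth_eq. Qed.

Lemma prox_smoothK x : prox_g g c (x + c *: grad g x) = x.
Proof.
have := gradient_step_expand (prox_g g c (x + c *: grad g x)) x.
rewrite prox_smooth_eq subrr enorm0 pmulr_rle0 ?subr_gt0// => le0.
by apply/eqP; rewrite -subr_eq0; apply/eqP/enorm_eq0/eqP; rewrite eq_le le0 enorm_ge0.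
Qed.

(** Evaluating the proximal problem at z + w with the minimizer for z, and
    conversely, encloses the increment of the Moreau envelope between two
    expressions that differ from c^-1 <z - x, w> by O(|w|^2), as the
    minimizer depends on z in a Lipschitz way. Finally z - x = c grad g(x). *)
Lemma grad_moreau_smooth z : grad_moreau_g g c z = grad g (prox_g g c z).
Proof.
set x := prox_g g c z; have xz : z - x = c *: grad g x.
  by rewrite -{1}[z]prox_smooth_eq addrC addKr.
have moreauE w : fine (moreau c (EFin \o g) w)
    = g (prox_g g c w) + c^-1 / 2 * enorm (prox_g g c w - w) ^+ 2.
  by rewrite (moreau_prox (prox_smoothP w)) /prox_obj/= inv2c.
have moreau_le w u : fine (moreau c (EFin \o g) w)
    <= g u + c^-1 / 2 * enorm (u - w) ^+ 2.
  by rewrite moreauE; have [_ _ /(_ u I)] := prox_smoothP w; rewrite /prox_obj/= inv2c lee_fin.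
apply/rowP => i; rewrite mxE.
rewrite (@derive_of_quadratic _ _ _ z (delta_mx 0 i) (dot (grad g x) (delta_mx 0 i))
  (c^-1 / 2 + c^-1 / (1 - c * M))).
  by rewrite dot_delta mxE.
move=> h /=; set w := h *: delta_mx 0 i.
have -> : h * dot (grad g x) (delta_mx 0 i) = c^-1 * dot (z - x) w.
  by rewrite xz dotZl dotZr mulKf ?gt_eqF.
have -> : h ^+ 2 = enorm w ^+ 2.
  by rewrite sqr_enorm dotZl dotZr dot_delta mxE !eqxx mulr1 expr2.
have up := moreau_le (z + w) x; have lo := moreau_le z (prox_g g c (z + w)).
move: up lo; rewrite !moreauE -/x; set x' := prox_g g c (z + w) => up lo.
have x'x : dot (x' - x) w <= (1 - c * M)^-1 * enorm w ^+ 2.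
  apply: le_trans (dot_le_enorm _ _) _.
  rewrite expr2 mulrA ler_wpM2r ?enorm_ge0// mulrC ler_pdivlMr ?subr_gt0// mulrC.
  by apply: le_trans (prox_smooth_lipschitz _ _) _; rewrite addrAC subrr add0r.
have cV : 0 <= c^-1 by rewrite invr_ge0 ltW.
have := ler_wpM2l cV x'x.
have := mulr_ge0 cV (sqr_ge0 (enorm w)).
have : 0 <= c^-1 / (1 - c * M) * enorm w ^+ 2.
  by rewrite mulr_ge0 ?divr_ge0 ?sqr_ge0// subr_ge0 ltW.
pose d := x - z; pose y := x' - (z + w).
have -> : x' - x = y + w - d.
  by apply/rowP => j; rewrite !mxE; ring.
move: up lo; have -> : x - (z + w) = d - w by rewrite /d opprD addrA.
have -> : x' - z = y + w by rewrite /y opprD addrA subrK.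
rewrite -/d -/y -(opprB x z) -/d; clearbody d y w.
move: (c^-1 / (1 - c * M)) (mulrA c^-1 (1 - c * M)^-1 (enorm w ^+ 2)) => K ->.
rewrite ler_norml !sqr_enorm !dotE !(dotC w).
move: (g x) (g x') (c^-1) (dot d d) (dot d w) (dot w w) (dot y w) (dot y y).
by move=> *; apply/andP; split; lra.
Qed.

End ProxSmooth.

(** * The forward-backward envelope *)

Section ForwardBackward.
Context {R : realType} {n : nat}.
Variables (f : 'rV[R]_n -> \bar R) (F : 'rV[R]_n -> R)
  (G : 'rV[R]_n -> 'rV[R]_n) (c K : R).

(** The objective f + F with F linearized at the base point x, plus the
    proximal term. *)
Definition fb_model (x u : 'rV[R]_n) : \bar R :=
  (f u + (F x + dot (G x) (u - x) + (2 * c)^-1 * enorm (u - x) ^+ 2)%:E)%E.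

Definition fb_envelope (x : 'rV[R]_n) : \bar R := ereal_inf (range (fb_model x)).

Hypothesis f_ninfty : forall x, f x != -oo%E.
Hypothesis FG : quadratic_approx K F G.
Hypothesis c_gt0 : 0 < c.
Hypothesis K_ge0 : 0 <= K.
Hypothesis cK_lt1 : c * K < 1.

Let ltKc : K < c^-1. Proof. by rewrite -(ltr_pM2l c_gt0) divff// gt_eqF. Qed.

Let inv2c : (2 * c)^-1 = c^-1 / 2. Proof. by field; rewrite gt_eqF. Qed.

Lemma fb_envelope_le x u : (fb_envelope x <= fb_model x u)%E.
Proof. by apply: ereal_inf_lbound; exists u. Qed.

Lemma fb_model_diag x : fb_model x x = (f x + (F x)%:E)%E.
Proof. by rewrite /fb_model subrr dot0r enorm0 expr0n mulr0 !addr0. Qed.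

Lemma fb_envelope_le_sum x : (fb_envelope x <= f x + (F x)%:E)%E.
Proof. by rewrite -fb_model_diag; exact: fb_envelope_le. Qed.

Lemma sum_le_fb_model x u : (f u + (F u)%:E <= fb_model x u)%E.
Proof.
apply: leeD2l; rewrite lee_fin inv2c.
have := FG x u; rewrite ler_norml => /andP[_].
have : K / 2 * enorm (u - x) ^+ 2 <= c^-1 / 2 * enorm (u - x) ^+ 2.
  by apply: ler_wpM2r; rewrite ?sqr_ge0 ?ler_pM2r ?invr_gt0 ?ltW.
lra.
Qed.

(** Replacing x by y = x + t d with d = u - x shrinks |u - x|^2 by (1 - t)^2
    and removes t <G y, d> from the linear term, while F changes by
    t <G y, d> up to K t^2 |d|^2 / 2; what is left is
    <G y - G x, d> <= K t |d|^2, itself a consequence of the quadratic bounds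
    at x and y. *)
Lemma fb_model_step (x u : 'rV[R]_n) (t : R) : 0 < t ->
  (fb_model (x + t *: (u - x)) u
     + (t * ((c^-1 - K) - t * ((c^-1 + K) / 2)) * enorm (u - x) ^+ 2)%:E
   <= fb_model x u)%E.
Proof.
move=> t_gt0; rewrite /fb_model -addeA -EFinD; apply: leeD2l; rewrite lee_fin inv2c.
set d := u - x; set y := x + t *: d.
have -> : u - y = (1 - t) *: d by apply/rowP => i; rewrite !mxE; ring.
have yx : y - x = t *: d by rewrite /y addrC addKr.
clearbody y d; have := FG x y; have := FG y x; rewrite -(opprB y x) yx.
rewrite enormN !enormZ (gtr0_norm t_gt0) !exprMn (real_normK (num_real _)).
rewrite !ler_norml !sqr_enorm !dotE => /andP[Fx_ge Fx_le] /andP[_ Fy_le].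
have : t * (dot (G y) d - dot (G x) d) <= t * (K * t * dot d d) by lra.
rewrite ler_pM2l// => ?; lra.
Qed.

(** The coefficient (1/c + K) / 4 is below 1 / (2c), so the proximal term beats
    the quadratic lower bound of f; it is 1 / (2c') for a step c' > c with
    c' K < 1. *)
Lemma fb_envelope_gt_ninfty x :
  bounded_below (add_sqnorm ((c^-1 + K) / 4) f) -> (-oo < fb_envelope x)%E.
Proof.
move=> [b fb]; pose k := (c^-1 - K) / 4.
have k_gt0 : 0 < k by rewrite divr_gt0// subr_gt0.
pose a := (c^-1 + K) / 4; pose v := G x - (2 * a) *: x.
apply: (@lt_le_trans _ _ (b - a * dot x x + F x - enorm v ^+ 2 / (4 * k))%:E).
  exact: ltNyr.
apply/ereal_infP => _ [u _ <-]; have := fb u; rewrite /fb_model /add_sqnorm.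
case: (f u) (f_ninfty u) => [r _| |//]; last by move=> *; rewrite addye ?leey.
rewrite -!EFinD !lee_fin -/a inv2c => r_ge.
have := dot_le_enorm (- v) (u - x); rewrite enormN dotNl => v_le.
(* minimum over |u - x| of k |u - x|^2 - |v| |u - x| *)
have : 0 <= k * (enorm (u - x) - enorm v / (2 * k)) ^+ 2.
  by rewrite mulr_ge0 ?sqr_ge0 ?ltW.
have -> : k * (enorm (u - x) - enorm v / (2 * k)) ^+ 2
    = k * enorm (u - x) ^+ 2 - enorm v * enorm (u - x) + enorm v ^+ 2 / (4 * k).
  by field; rewrite gt_eqF.
have uE : u = x + (u - x) by rewrite addrC subrK.
move: r_ge v_le; rewrite {1}uE; move: (u - x) => d.
move: (enorm v ^+ 2 / (4 * k)) => e.
rewrite [enorm (x + d) ^+ 2]sqr_enorm [enorm d ^+ 2]sqr_enorm.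
rewrite /v !dotE (dotC d x) /k /a; lra.
Qed.

(** Weak convexity in real terms, after expanding the squared norms: the
    defect of convexity is b / 2 times t (1 - t) |u - x|^2. *)
Lemma weakly_convex_fin (u x : 'rV[R]_n) (b r s t : R) :
  weakly_convex b f -> 0 <= t <= 1 -> f u = r%:E -> f x = s%:E ->
  exists2 q, f (t *: u + (1 - t) *: x) = q%:E &
    q <= t * r + (1 - t) * s + b / 2 * (t * (1 - t) * enorm (u - x) ^+ 2).
Proof.
move=> fb t01 fu fx; have := fb u x t t01; rewrite /add_sqnorm fu fx.
case: (f _) (f_ninfty (t *: u + (1 - t) *: x)) => [q _| |//]; last by [].
move=> q_le; exists q => //.
have : q + b / 2 * enorm (t *: u + (1 - t) *: x) ^+ 2
    <= t * (r + b / 2 * enorm u ^+ 2) + (1 - t) * (s + b / 2 * enorm x ^+ 2).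
  by rewrite -lee_fin.
by rewrite !sqr_enorm !dotE (dotC x u); lra.
Qed.

(** Only points u outside the ball need an argument. Let w be where the
    segment from x to u leaves the ball. The model at y exceeds the sum f + F by
    at least k |w - y|^2 at w and by at most C |x - y|^2 at x, with k > 0; the
    radius eta is chosen so that |x - y| <= eta forces
    C |x - y|^2 <= k |w - y|^2, and convexity of the model along the segment
    transfers the bound to u. *)
Lemma fb_envelope_locally_ge (b delta : R) (x : 'rV[R]_n) : weakly_convex b f -> c * b < 1 ->
  0 < delta -> argmin (eball x delta) (fun u => f u + (F u)%:E)%E x ->
  exists2 eta, 0 < eta &
    forall y, enorm (y - x) <= eta -> (f x + (F x)%:E <= fb_envelope y)%E.
Proof.
move=> fb cb_lt1 delta_gt0 [_ fx_fin xmin].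
have b_lt : b < c^-1 by rewrite -(ltr_pM2l c_gt0) divff// gt_eqF.
pose k := (c^-1 - K) / 2; pose C := (c^-1 + K) / 2.
have k_gt0 : 0 < k by rewrite divr_gt0// subr_gt0.
have leCk : k <= C by have := K_ge0; rewrite /k /C; lra.
have C_gt0 := lt_le_trans k_gt0 leCk.
pose eta := delta * k / (C + k).
have eta_gt0 : 0 < eta by apply: divr_gt0; [exact: mulr_gt0 | exact: addr_gt0].
have etaE : k * (delta - eta) = C * eta by rewrite /eta; field; rewrite gt_eqF ?addr_gt0.
have eta_le : eta <= delta - eta.
  by rewrite -(ler_pM2l k_gt0) etaE ler_wpM2r// ltW.
exists eta => // y yx; apply/ereal_infP => _ [u _ <-].
have [ux|ux] := lerP (enorm (x - u)) delta.
  by apply: le_trans (sum_le_fb_model y u); exact: xmin.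
case fuE : (f u) (f_ninfty u) => [r| |//] _; last by rewrite /fb_model fuE leey.
case fxE : (f x) (f_ninfty x) fx_fin => [s| |//] _ // _.
pose t := delta / enorm (u - x).
have d_gt0 : 0 < enorm (u - x) by rewrite enormBC; exact: lt_trans ux.
have t_gt0 : 0 < t by rewrite divr_gt0.
have t_lt1 : t < 1 by rewrite ltr_pdivrMr// mul1r enormBC.
have t01 : 0 <= t <= 1 by rewrite (ltW t_gt0) (ltW t_lt1).
have [q fwE q_le] := weakly_convex_fin fb t01 fuE fxE.
move: fwE; set w := _ + _ => fwE.
have wxE : w - x = t *: (u - x) by apply/rowP => i; rewrite !mxE; ring.
have wx : enorm (w - x) = delta.
  by rewrite wxE enormZ (gtr0_norm t_gt0) divfK// gt_eqF.
have := xmin w; rewrite /eball/closed_ball_/= enormBC wx => /(_ (lexx _)).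
rewrite fwE fxE lee_fin => sq.
rewrite /fb_model fuE -!EFinD lee_fin inv2c.
(* eta solves k (delta - eta) = C eta, and eta <= delta - eta <= |w - y| *)
have far : C * enorm (x - y) ^+ 2 <= k * enorm (w - y) ^+ 2.
  have yx' : enorm (x - y) <= eta by rewrite enormBC.
  have wy : delta - eta <= enorm (w - y).
    have := enormD (w - y) (y - x); rewrite addrA subrK wx; lra.
  apply: (@le_trans _ _ (C * (eta * (delta - eta)))).
    apply: ler_wpM2l; first exact: ltW.
    by rewrite expr2; apply: ler_pM; rewrite ?enorm_ge0// (le_trans yx').
  rewrite mulrA -etaE -mulrA; apply: ler_wpM2l; first exact: ltW.
  have de_ge0 : 0 <= delta - eta by apply: le_trans eta_le; exact: ltW.
  by rewrite expr2; apply: ler_pM.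
have := FG y w; have := FG y x; rewrite !ler_norml => /andP[Fx_ge _] /andP[_ Fw_le].
have WE : enorm (w - y) ^+ 2 = t * enorm (u - y) ^+ 2 + (1 - t) * enorm (x - y) ^+ 2
    - t * (1 - t) * enorm (u - x) ^+ 2.
  rewrite -(subrKA y u (- x)) -(opprB x y).
  have -> : w - y = t *: (u - y) + (1 - t) *: (x - y).
    by apply/rowP => i; rewrite !mxE; ring.
  move: (u - y) (x - y) => a d; rewrite !sqr_enorm !dotE (dotC d a); ring.
have GwE : dot (G y) (w - y) = t * dot (G y) (u - y) + (1 - t) * dot (G y) (x - y).
  by rewrite /w !dotE; ring.
have t1_ge0 : 0 <= 1 - t by rewrite subr_ge0 ltW.
have bN : b / 2 * (t * (1 - t) * enorm (u - x) ^+ 2)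
    <= c^-1 / 2 * (t * (1 - t) * enorm (u - x) ^+ 2).
  apply: ler_wpM2r; last by rewrite ler_pM2r ?invr_gt0 ?ltr0Sn// ltW.
  by apply: mulr_ge0; [exact: mulr_ge0 (ltW t_gt0) t1_ge0 | exact: sqr_ge0].
have X_ge0 := mulr_ge0 (ltW C_gt0) (sqr_ge0 (enorm (x - y))).
rewrite -(ler_pM2l t_gt0).
move: Fw_le far bN; rewrite GwE WE.
have : (1 - t) * (F y + dot (G y) (x - y)) <= (1 - t) * (F x + K / 2 * enorm (x - y) ^+ 2).
  by apply: ler_wpM2l => //; lra.
have := mulr_ge0 (ltW t_gt0) X_ge0; move: q_le sq; rewrite /C /k.
move: (enorm (x - y) ^+ 2) (enorm (u - y) ^+ 2) (enorm (u - x) ^+ 2) => X U N.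
move: (dot (G y) (x - y)) (dot (G y) (u - y)) (c^-1) => B A ic.
lra.
Qed.

(** Suppose p = fb_envelope x is below the sum f + F at x. Near x the model stays
    above p + s by lower semicontinuity. At distance at least r, moving the base
    point by s0 <= rho towards u costs the model at least s0 r k / 2
    and leaves it at least p. So the infimum p would be at least p + eta. *)
Lemma sum_le_fb_envelope (rho : R) (x : 'rV[R]_n) : lower_semicontinuous f ->
  (-oo < fb_envelope x < +oo)%E -> 0 < rho ->
  (forall y, enorm (y - x) <= rho -> (fb_envelope x <= fb_envelope y)%E) ->
  (f x + (F x)%:E <= fb_envelope x)%E.
Proof.
move=> f_lsc /andP[gtNoo ltoo] rho_gt0 xmin; rewrite leNgt; apply/negP.
case pE : (fb_envelope x) gtNoo ltoo => [p| |]// _ _ p_lt.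
have [a a_lt pa] : exists2 a : R, (a%:E < f x)%E & p < a + F x.
  case: (f x) (f_ninfty x) p_lt => [s _| _ _|//].
    rewrite -EFinD lte_fin => ps; exists ((s + p - F x) / 2); last by lra.
    by rewrite lte_fin; lra.
  by exists (p - F x + 1); [exact: ltry | lra].
have [V Vx fV] := f_lsc x a a_lt; have [r0 r0_gt0 r0V] := nbhs_enorm Vx.
pose s := (a + F x - p) / 2; have s_gt0 : 0 < s by rewrite divr_gt0 ?subr_gt0.
pose N := enorm (G x) + 1.
have N_gt0 : 0 < N by rewrite ltr_wpDl ?enorm_ge0.
pose r := Num.min r0 (s / N).
have r_gt0 : 0 < r by rewrite lt_min r0_gt0 divr_gt0.
pose k := c^-1 - K; pose C := (c^-1 + K) / 2.
have k_gt0 : 0 < k by rewrite subr_gt0.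
have cV_gt0 : 0 < c^-1 by rewrite invr_gt0.
have C_gt0 : 0 < C by rewrite divr_gt0// ltr_wpDr.
(* the shift s0 = t |u - x| is such that t C <= k / 2 as soon as |u - x| >= r,
   so that the second-order term takes at most half of the decrease *)
pose s0 := Num.min (k / (2 * C) * r) rho.
have s0_gt0 : 0 < s0.
  rewrite lt_min rho_gt0 andbT; apply: mulr_gt0 => //.
  by apply: divr_gt0 => //; exact: mulr_gt0.
pose eta := Num.min s (s0 * r * (k / 2)).
have eta_gt0 : 0 < eta.
  rewrite lt_min s_gt0 /=; apply: mulr_gt0; first exact: mulr_gt0.
  by rewrite divr_gt0.
suff : ((p + eta)%:E <= fb_envelope x)%E by rewrite pE lee_fin gerDl leNgt eta_gt0.
apply/ereal_infP => _ [u _ <-].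
case fuE : (f u) (f_ninfty u) => [q| |//] _; last by rewrite /fb_model fuE addye ?leey.
have [ux|ux] := ltrP (enorm (u - x)) r.
  have aq : a < q.
    by rewrite -lte_fin -fuE; apply/fV/r0V; apply: lt_le_trans ux _; rewrite ge_min lexx.
  apply: (@le_trans _ _ (p + s)%:E); first by rewrite lee_fin lerD2l ge_min lexx.
  rewrite /fb_model fuE -EFinD lee_fin inv2c.
  have := dot_le_enorm (- G x) (u - x); rewrite dotNl enormN => G_le.
  have Ns : N * enorm (u - x) <= s.
    rewrite mulrC -ler_pdivlMr//; apply: ltW; apply: lt_le_trans ux _.
    by rewrite ge_min lexx orbT.
  have : enorm (G x) * enorm (u - x) <= N * enorm (u - x).
    by rewrite ler_wpM2r ?enorm_ge0// lerDl.
  have : 0 <= c^-1 / 2 * enorm (u - x) ^+ 2.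
    by rewrite mulr_ge0 ?sqr_ge0// divr_ge0 ?ltW.
  by move: Ns; rewrite /s; lra.
apply: (@le_trans _ _ (p + s0 * r * (k / 2))%:E).
  by rewrite lee_fin lerD2l ge_min lexx orbT.
have d_gt0 : 0 < enorm (u - x) by exact: lt_le_trans ux.
pose t := s0 / enorm (u - x); have t_gt0 : 0 < t by rewrite divr_gt0.
have td : t * enorm (u - x) = s0 by rewrite divfK// gt_eqF.
apply: le_trans (fb_model_step x u t_gt0).
have : (p%:E <= fb_model (x + t *: (u - x)) u)%E.
  rewrite -pE; apply: le_trans (fb_envelope_le _ _); apply: xmin.
  by rewrite addrAC subrr add0r enormZ (gtr0_norm t_gt0) td ge_min lexx orbT.
move=> p_le; rewrite EFinD; apply: leeD => //; rewrite lee_fin.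
have tC : t * C <= k / 2.
  have : s0 <= k / (2 * C) * r by rewrite ge_min lexx.
  rewrite -td => /le_trans/(_ (ler_wpM2l _ ux)) td_le.
  have : t <= k / (2 * C).
    rewrite -(ler_pM2r d_gt0); apply: td_le.
    by apply: divr_ge0; [exact: ltW | apply: mulr_ge0 => //; exact: ltW].
  move=> /(ler_wpM2r (ltW C_gt0)).
  by have -> : k / (2 * C) * C = k / 2 by field; rewrite gt_eqF.
apply: (@le_trans _ _ (s0 * enorm (u - x) * (k / 2))).
  apply: ler_wpM2r; first by rewrite divr_ge0 ?ltW.
  by rewrite ler_wpM2l// ltW.
rewrite -td -/k -/C.
have -> : t * (k - t * C) * enorm (u - x) ^+ 2
   = t * enorm (u - x) * enorm (u - x) * (k - t * C) by ring.
apply: ler_wpM2l; last by lra.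
by rewrite mulr_ge0 ?enorm_ge0// td ltW.
Qed.

End ForwardBackward.

(** * Admissible steps and Lipschitz constants *)

Section Constants.
Context {R : realType}.

Lemma lt_einvP (c K : R) : 0 < c ->
  (c%:E < K%:E^-1)%E <-> 0 <= K /\ c * K < 1.
Proof.
move=> c_gt0; rewrite inver; have [->|K0] := eqVneq K 0.
  by rewrite mulr0 ltr01 lexx; split => // _; exact: ltry.
rewrite lte_fin; split => [cK|[K_ge0 cK]].
  have K_gt0 : 0 < K by rewrite -invr_gt0; exact: lt_trans cK.
  by rewrite ltW// -(@mulVf _ K)// ltr_pM2r.
have K_gt0 : 0 < K by rewrite lt_def K0.
by rewrite -(ltr_pM2r K_gt0) mulVf.
Qed.

(** A negative Lipschitz constant is possible, but only on the zero space,
    where the operator norm vanishes. *)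
Lemma lipschitz_opnorm_ge0 n m (L : {linear 'rV[R]_n -> 'rV[R]_m})
    (M : R) (h : 'rV[R]_m -> R) :
  lipschitz_differentiable M h -> 0 <= M * opnorm L ^+ 2.
Proof.
move=> [_ lip]; have [M_ge0|M_lt0] := lerP 0 M; first by rewrite mulr_ge0 ?sqr_ge0.
have y0 (y : 'rV[R]_m) : enorm y = 0.
  have := le_trans (enorm_ge0 _) (lip y 0); rewrite subr0 nmulr_rge0// => y_le0.
  by apply/eqP; rewrite eq_le y_le0 enorm_ge0.
rewrite (_ : opnorm L = 0) ?expr0n ?mulr0//.
apply/eqP; rewrite eq_le opnorm_ge0 andbT; apply: ge_sup.
  by exists (enorm (L 0)); exists 0 => //=; rewrite enorm0 ler01.
by move=> _ [x _ <-]; rewrite y0.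
Qed.

Lemma lipschitz_le_opnorm n m (L : {linear 'rV[R]_n -> 'rV[R]_m})
    (M : R) (h : 'rV[R]_m -> R) x :
  lipschitz_differentiable M h ->
  M * enorm (L x) ^+ 2 <= M * opnorm L ^+ 2 * enorm x ^+ 2.
Proof.
move=> hM; have [M_ge0|M_lt0] := lerP 0 M.
  rewrite -mulrA -exprMn ler_wpM2l// ler_pXn2r ?nnegrE ?enorm_ge0 ?enorm_le_opnorm//.
  by rewrite mulr_ge0 ?opnorm_ge0 ?enorm_ge0.
apply: (@le_trans _ _ 0); first by rewrite nmulr_rle0// sqr_ge0.
by rewrite mulr_ge0 ?sqr_ge0 ?(lipschitz_opnorm_ge0 L hM).
Qed.

End Constants.

(** * The three-operator envelope *)

Section DavisYin.
Context {R : realType} {n m : nat}.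
Variables (L : {linear 'rV[R]_n -> 'rV[R]_m}) (f : 'rV[R]_n -> \bar R)
  (g : 'rV[R]_n -> R) (h : 'rV[R]_m -> R).

Definition smooth_part (x : 'rV[R]_n) : R := g x + h (L x).

Definition smooth_grad (x : 'rV[R]_n) : 'rV[R]_n :=
  grad g x + adjoint L (grad h (L x)).

Lemma objectiveE : objective L f g h = (fun x => f x + (smooth_part x)%:E)%E.
Proof. by apply/funext => x; rewrite /objective EFinD addeA. Qed.

Variables (Lg Lh c : R).
Hypothesis g_smooth : lipschitz_differentiable Lg g.
Hypothesis h_smooth : lipschitz_differentiable Lh h.
Hypothesis c_gt0 : 0 < c.
Hypothesis cLg_lt1 : c * Lg < 1.

Lemma smooth_part_approx :
  quadratic_approx (Lg + Lh * opnorm L ^+ 2) smooth_part smooth_grad.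
Proof.
apply: quadratic_approxD; first exact: quadratic_approx_grad.
apply: quadratic_approx_linear (quadratic_approx_grad h_smooth) => x.
exact: lipschitz_le_opnorm h_smooth.
Qed.

(** With a = grad g(x) and q as in the envelope, z = x + c a, so f is evaluated
    by its Moreau envelope at x - c (a + q). Expanding |u - x + c (a + q)|^2
    produces the linear term <a + q, u - x>, and the remaining terms in a and q
    cancel those outside the Moreau envelope. *)
Lemma envelopeE z : envelope L f g h c z
  = fb_envelope f smooth_part smooth_grad c (prox_g g c z).
Proof.
set x := prox_g g c z.
have xz : x + c *: grad g x = z := prox_smooth_eq c_gt0 cLg_lt1 g_smooth z.
rewrite /envelope /qvec (grad_moreau_smooth c_gt0 cLg_lt1 g_smooth).
rewrite (moreau_prox (prox_smoothP c_gt0 cLg_lt1 g_smooth z)) -/x /prox_obj/=.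
set q := adjoint _ _; set a := grad g x.
rewrite /moreau -!(EFinB, EFinD) ereal_infDl; congr ereal_inf; apply: eq_imagel => u _.
rewrite /prox_obj /fb_model addeCA -EFinD; congr (_ + _%:E)%E.
rewrite /smooth_part /smooth_grad -/q -/a.
have -> : x - z = - (c *: a) by rewrite -xz opprD addrA subrr add0r.
have -> : u - (z - (2 * c) *: a - c *: q) = (u - x) + c *: (a + q).
  by rewrite -xz -/a; apply/rowP => i; rewrite !mxE; ring.
move: (u - x) => d; clearbody a q.
rewrite !sqr_enorm !dotE (dotC q a) (dotC d a) (dotC d q); field.
by rewrite gt_eqF.
Qed.

End DavisYin.

(** * Local minimizers *)

Theorem theorem6 (R : realType) (n m : nat)
  (L : {linear 'rV[R]_n -> 'rV[R]_m})
  (f : 'rV[R]_n -> \bar R) (g : 'rV[R]_n -> R) (h : 'rV[R]_m -> R)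
  (Lg Lh bf c : R)
  (g_smooth : lipschitz_differentiable Lg g)
  (h_smooth : lipschitz_differentiable Lh h)
  (f_proper : proper f)
  (f_lsc : lower_semicontinuous f)
  (c_gt0 : 0 < c)
  (c_lt : (c%:E < (Lg + Lh * opnorm L ^+ 2)%:E^-1)%E)
  (f_bounded : forall c' : R, 0 < c' ->
     (c'%:E < (Lg + Lh * opnorm L ^+ 2)%:E^-1)%E ->
     bounded_below (add_sqnorm (2 * c')^-1 f))
  (f_weakly_convex : weakly_convex bf f)
  (c_lt_bf : (c%:E < bf%:E^-1)%E)
  (g_C2 : twice_continuously_differentiable g)
  (h_C2 : twice_continuously_differentiable h)
  (zs : 'rV[R]_n) :
  (forall delta : R, 0 < delta ->
     argmin (eball (prox_g g c zs) delta) (objective L f g h) (prox_g g c zs) ->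
     local_minimizer (envelope L f g h c) zs) /\
  (forall eps : R, 0 < eps ->
     argmin (eball zs eps) (envelope L f g h c) zs ->
     (forall z : 'rV[R]_n, enorm (z - zs) <= eps ->
        (objective L f g h (prox_g g c zs) <= objective L f g h (prox_g g c z))%E) /\
     local_minimizer (objective L f g h) (prox_g g c zs)).
Proof.
have [K_ge0 cK_lt1] := (lt_einvP _ c_gt0).1 c_lt.
have [_ cbf_lt1] := (lt_einvP _ c_gt0).1 c_lt_bf.
have LhL_ge0 := lipschitz_opnorm_ge0 L h_smooth.
set K := Lg + _ in K_ge0 cK_lt1 c_lt f_bounded.
have LgK : c * Lg <= c * K by rewrite ler_pM2l// lerDl.
have cLg_lt1 : c * Lg < 1 := le_lt_trans LgK cK_lt1.
have f_ninfty := f_proper.1.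
have FG := smooth_part_approx L g_smooth h_smooth; rewrite -/K in FG.
have envE z := envelopeE L f h g_smooth c_gt0 cLg_lt1 z.
pose fbe := fb_envelope f (smooth_part L g h) (smooth_grad L g h) c.
pose P := prox_g g c; pose xs := P zs.
have P_lip z z' : (1 - c * Lg) * enorm (P z - P z') <= enorm (z - z').
  exact: (prox_smooth_lipschitz c_gt0 cLg_lt1 g_smooth).
have PK x : P (x + c *: grad g x) = x by exact: (prox_smoothK c_gt0 cLg_lt1 g_smooth).
have PE z : P z + c *: grad g (P z) = z by exact: (prox_smooth_eq c_gt0 cLg_lt1 g_smooth).
have fbe_le x : (fbe x <= objective L f g h x)%E.
  by rewrite objectiveE; exact: fb_envelope_le_sum.
split=> [delta delta_gt0 xs_min|eps eps_gt0 [_ zs_fin zs_min]].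
  have xs_fin := let: And3 _ fin _ := xs_min in fin.
  rewrite objectiveE in xs_min.
  have [eta eta_gt0 xs_le] := fb_envelope_locally_ge f_ninfty FG c_gt0 K_ge0 cK_lt1
    f_weakly_convex cbf_lt1 delta_gt0 xs_min.
  have r_gt0 : 0 < (1 - c * Lg) * eta by rewrite mulr_gt0// subr_gt0.
  exists ((1 - c * Lg) * eta); first exact: r_gt0.
  split=> [||z].
  - by rewrite /eball/closed_ball_/= subrr enorm0 ltW.
  - by rewrite envE; exact: le_lt_trans (fbe_le _) xs_fin.
  rewrite /eball/closed_ball_/= enormBC => z_le.
  rewrite !envE; apply: le_trans (fbe_le _) _; rewrite objectiveE; apply: xs_le.
  rewrite -(ler_pM2l (_ : 0 < 1 - c * Lg)) ?subr_gt0//.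
  exact: le_trans (P_lip _ _) z_le.
pose rho := eps / (1 + c * `|Lg|).
have den_gt0 : 0 < 1 + c * `|Lg| by rewrite ltr_pwDl// mulr_ge0// ltW.
have rho_gt0 : 0 < rho by rewrite divr_gt0.
have step_le y : enorm (y - xs) <= rho -> enorm ((y + c *: grad g y) - zs) <= eps.
  rewrite ler_pdivlMr// => y_le; apply: le_trans y_le.
  rewrite -[in leLHS](PE zs) -/xs.
  have -> : y + c *: grad g y - (xs + c *: grad g xs)
      = (y - xs) + c *: (grad g y - grad g xs).
    by rewrite scalerBr; apply/rowP => i; rewrite !mxE; ring.
  apply: le_trans (enormD _ _) _; rewrite enormZ (gtr0_norm c_gt0) mulrDr mulr1 lerD2l.
  rewrite mulrCA; apply: ler_wpM2l; first exact: ltW.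
  apply: le_trans (g_smooth.2 _ _) _; rewrite mulrC.
  by apply: ler_wpM2l; [exact: enorm_ge0 | exact: ler_norm].
have zs_le z : enorm (z - zs) <= eps -> (fbe xs <= fbe (P z))%E.
  by move=> z_le; rewrite /fbe -!envE; apply: zs_min; rewrite /eball/closed_ball_/= enormBC.
have xs_le y : enorm (y - xs) <= rho -> (fbe xs <= fbe y)%E.
  by move=> /step_le/zs_le; rewrite PK.
have fbe_xs_fin : (-oo < fbe xs < +oo)%E.
  rewrite /fbe -envE zs_fin andbT envE.
  (* a step larger than c that still satisfies c' K < 1 *)
  pose c' := 2 * c / (1 + c * K).
  have cK1 : 0 < 1 + c * K by rewrite ltr_pwDl// mulr_ge0// ltW.
  have c'_gt0 : 0 < c' by apply: divr_gt0 => //; exact: mulr_gt0.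
  have c'E : (2 * c')^-1 = (c^-1 + K) / 4.
    by rewrite /c'; field; rewrite !gt_eqF.
  apply: (fb_envelope_gt_ninfty _ _ f_ninfty c_gt0 cK_lt1).
  rewrite -c'E; apply: f_bounded; first exact: c'_gt0.
  by apply/lt_einvP => //; split => //; rewrite mulrAC ltr_pdivrMr//; lra.
have objective_le : (objective L f g h xs <= fbe xs)%E.
  rewrite objectiveE; exact: (sum_le_fb_envelope f_ninfty FG c_gt0 K_ge0 cK_lt1 f_lsc
    fbe_xs_fin rho_gt0 xs_le).
split=> [z z_le|].
  apply: le_trans objective_le _; exact: le_trans (zs_le _ z_le) (fbe_le _).
exists rho; first exact: rho_gt0.
split=> [||y].
- by rewrite /eball/closed_ball_/= subrr enorm0 ltW.
- by case/andP: fbe_xs_fin => _; exact: le_lt_trans.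
rewrite /eball/closed_ball_/= enormBC => y_le.
apply: le_trans objective_le _; exact: le_trans (xs_le _ y_le) (fbe_le _).
Qed.
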